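(* Let $\mathcal L\subset\mathfrak F(\Omega)$ be a vector lattice containing $\mathcal B_*$, $C\subset\mathcal L$ a convex set containing the origin, and $\gamma:\mathcal L\to\mathbb R$ a $\ge_*$-monotone, subadditive and positively homogeneous functional. Then $$\gamma\Big(\sum_{n=1}^Nf_n\Big)=\sum_{n=1}^N\gamma(f_n)\qquad\text{for all }N\text{ and }f_1,\ldots,f_N\in C$$ if and only if there exist (i) a positive linear functional $\beta$ on $\mathcal L$ vanishing on $\mathcal B_*$ and (ii) $m\in ba_{*,+}$ with $\mathcal L\subset L^1(m)$, such that $$\gamma(h)\ge\beta(h)+\int h\,dm\quad\text{and}\quad\gamma(f)=\beta(f)+\int f\,dm\qquad\text{for all }h\in\mathcal L,\ f\in C.$$
   Context: $\Omega$ is a nonempty set, $\mathfrak F(\Omega)$ the real functions on $\Omega$ (inequalities, $|\cdot|$ pointwise; constants are constant functions). $\ge_*$ is a reflexive, transitive relation on $\mathfrak F(\Omega)$ with (TRIV) $0\not\ge_*1$; (CONE) $f_i\ge_*g_i$, $a_i\ge0$ ($i=1,2$) imply $a_1f_1+a_2f_2\ge_*a_1g_1+a_2g_2$; (CERT) $f\ge0\Rightarrow f\ge_*0$; (APPR) $f+2^{-n}\ge_*0$ for all $n$ implies $f\ge_*0$; (REST) $f\ge_*0$, $A\subset\Omega$ imply $f1_A\ge_*0$. $\mathcal N_*=\{A:0\ge_*1_A\}$, $\mathcal B_*=\{f:\eta\ge_*|f|\text{ for some real }\eta>0\}$, $ba_{*,+}$ = nonnegative bounded finitely additive set functions on all subsets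 of $\Omega$ vanishing on $\mathcal N_*$. $\gamma$ is $\ge_*$-monotone if $f\ge_*g$ implies $\gamma(f)\ge\gamma(g)$. A positive linear functional $\beta$ satisfies $\beta(f)\ge0$ whenever $f\ge0$. Integrals: $\int f\,dm:=\lim_n\int[(f^+\wedge n)-(f^-\wedge n)]dm$ if the limit exists in $[-\infty,\infty]$, else $\infty$; $L^1(m)$ is the space of $m$-integrable functions (Dunford–Schwartz). *)

(* Defs.v *)
From HB Require Import structures.
From mathcomp Require Import all_boot all_order all_algebra.
From mathcomp Require Import all_classical all_reals all_analysis.
Set Implicit Arguments. Unset Strict Implicit. Unset Printing Implicit Defensive.
Import Order.TTheory GRing.Theory Num.Theory.
Import numFieldNormedType.Exports.
Local Open Scope classical_set_scope.
Local Open Scope ring_scope.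

Section Defs.
Variables (R : realType) (Omega : Type).
Notation F := (Omega -> R).

Definition ind (A : set Omega) : F := fun x => if `[< A x >] then 1 else 0.

Definition star_order (ge : F -> F -> Prop) : Prop :=
  [/\ (forall f, ge f f),
      (forall f g h, ge f g -> ge g h -> ge f h) &
  [/\ (* TRIV *) ~ ge (fun _ => 0) (fun _ => 1),
      (* CONE *) (forall f1 f2 g1 g2 (a1 a2 : R), ge f1 g1 -> ge f2 g2 ->
                   0 <= a1 -> 0 <= a2 ->
                   ge (fun x => a1 * f1 x + a2 * f2 x) (fun x => a1 * g1 x + a2 * g2 x)),
      (* CERT *) (forall f, (forall x, 0 <= f x) -> ge f (fun _ => 0)),
      (* APPR *) (forall f, (forall n : nat, ge (fun x => f x + (2 : R) ^- n) (fun _ => 0)) ->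
                   ge f (fun _ => 0)) &
      (* REST *) (forall f (A : set Omega), ge f (fun _ => 0) ->
                   ge (fun x => f x * ind A x) (fun _ => 0))]].

Definition null_star (ge : F -> F -> Prop) : set (set Omega) :=
  [set A | ge (fun _ => 0) (ind A)].

Definition bounded_star (ge : F -> F -> Prop) : set F :=
  [set f | exists eta : R, 0 < eta /\ ge (fun _ => eta) (fun x => `|f x|)].

Definition ba_star_plus (ge : F -> F -> Prop) : set (set Omega -> R) :=
  [set m | [/\ (forall A, 0 <= m A),
               (exists c : R, forall A, m A <= c),
               (forall A B, A `&` B = set0 -> m (A `|` B) = m A + m B) &
               (forall A, null_star ge A -> m A = 0)]].

Definition vector_lattice (L : set F) : Prop :=
  [/\ L (fun _ => 0),
      (forall f g, L f -> L g -> L (fun x => f x + g x)),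
      (forall (a : R) f, L f -> L (fun x => a * f x)),
      (forall f g, L f -> L g -> L (fun x => Num.max (f x) (g x))) &
      (forall f g, L f -> L g -> L (fun x => Num.min (f x) (g x)))].

Definition convexF (C : set F) : Prop :=
  forall f g (t : R), C f -> C g -> 0 <= t <= 1 ->
    C (fun x => t * f x + (1 - t) * g x).

(* Dunford--Schwartz integration w.r.t. a nonnegative finitely additive m
   defined on the algebra of all subsets (so the outer measure is m itself
   and every finite-valued function is simple). *)
Definition simple (f : F) : Prop := finite_set (range f).

Definition sint (m : set Omega -> R) (f : F) : R :=
  (\sum_(r \in range f) r * m (f @^-1` [set r]))%R.

Definition determining (m : set Omega -> R) (f : F) (s : nat -> F) : Prop :=
  [/\ (forall n, simple (s n)),
      (forall e : R, 0 < e ->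
         (fun n => m [set x | e < `|s n x - f x|]) @ \oo --> (0 : R)) &
      (forall e : R, 0 < e -> exists N : nat, forall n k, (N <= n)%N -> (N <= k)%N ->
         sint m (fun x => `|s n x - s k x|) < e)].

Definition is_DSint (m : set Omega -> R) (f : F) (v : R) : Prop :=
  exists s, determining m f s /\ (fun n => sint m (s n)) @ \oo --> v.

Definition L1 (m : set Omega -> R) : set F := [set f | exists v, is_DSint m f v].

Definition DSint (m : set Omega -> R) (f : F) : R := xget 0 [set v | is_DSint m f v].

Definition trunc (n : nat) (f : F) : F :=
  fun x => Num.min (Num.max (f x) 0) n%:R - Num.min (Num.max (- f x) 0) n%:R.

(* the paper's integral: limit in [-oo,+oo] of the integrals of the
   truncations if it exists, +oo otherwise *)
Definition pint (m : set Omega -> R) (f : F) : \bar R :=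
  xget +oo%E [set l : \bar R | (fun n => (DSint m (trunc n f))%:E) @ \oo --> l].

End Defs.

(* Main.v *)
Require Import Defs.
From HB Require Import structures.
From mathcomp Require Import all_boot all_order all_algebra.
From mathcomp Require Import all_classical all_reals all_analysis.
From mathcomp Require Import finmap ring lra.
Set Implicit Arguments. Unset Strict Implicit. Unset Printing Implicit Defensive.
Import Order.TTheory GRing.Theory Num.Theory.
Import numFieldNormedType.Exports.
Local Open Scope classical_set_scope.
Local Open Scope ring_scope.

(** Suppose [gamma] is additive on [C]. It is then additive on the cone [K]
    spanned by [C], so [h |-> inf_(k in K) (gamma (h + k) - gamma k)] is a
    sublinear functional below [gamma] whose linear minorants agree with
    [gamma] on [C]. A minimal sublinear functional below it is such a linear
    minorant [phi]. Being dominated by [gamma], [phi] is monotone for [ge], hence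
    [m A := phi (ind A)] lies in [ba_{*,+}]; the truncations of [h] at level [n]
    have integral [phi (trunc n h)], whose limit is the integral of [h], and
    [beta := phi - integral] is the part of [phi] carried by unbounded functions.
    Conversely, [beta] plus the integral is linear, lies below [gamma] and agrees
    with it on [C], which gives superadditivity of [gamma] along [C]. *)

(** * Sublinear functionals and their linear minorants *)

Section HahnBanach.
Variables (R : realType) (V : lmodType R).
Implicit Types (L K : set V) (p q : V -> R).

Definition submodule L : Prop :=
  [/\ L 0, (forall x y, L x -> L y -> L (x + y)) &
      (forall (a : R) x, L x -> L (a *: x))].

(** Homogeneity is asked only as an inequality for positive scalars, a form that infima inherit
    directly; applying it to the inverse scalar recovers equality. *)
Definition sublinear_on L q : Prop :=
  (forall x y, L x -> L y -> q (x + y) <= q x + q y) /\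
  (forall (a : R) x, 0 < a -> L x -> q (a *: x) <= a * q x).

Definition linear_on L q : Prop :=
  forall (a b : R) x y, L x -> L y -> q (a *: x + b *: y) = a * q x + b * q y.

Lemma submoduleN L x : submodule L -> L x -> L (- x).
Proof. by case=> _ _ LZ Lx; rewrite -scaleN1r; exact: LZ. Qed.

Lemma sublinear_onZ L q : submodule L -> sublinear_on L q ->
  forall (a : R) x, 0 < a -> L x -> q (a *: x) = a * q x.
Proof.
move=> [_ _ LZ] [_ qZ] a x a0 Lx; apply/eqP; rewrite eq_le qZ//=.
have /(qZ a^-1 (a *: x)) : 0 < a^-1 by rewrite invr_gt0.
rewrite scalerA mulVf ?gt_eqF// scale1r => /(_ (LZ _ _ Lx)).
by rewrite mulrC ler_pdivlMr// mulrC.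
Qed.

Lemma sublinear_on0 L q : submodule L -> sublinear_on L q -> q 0 = 0.
Proof.
move=> Ls qs; have [L0 _ _] := Ls.
have := sublinear_onZ Ls qs (ltr0Sn R 1) L0; rewrite scaler0 => ?; lra.
Qed.

Lemma sublinear_onN L q x : submodule L -> sublinear_on L q -> L x ->
  - q (- x) <= q x.
Proof.
move=> Ls qs Lx; have := qs.1 x (- x) Lx (submoduleN Ls Lx).
rewrite subrr (sublinear_on0 Ls qs) => ?; lra.
Qed.

(** For a convex cone [K] on which [q] is additive, this is the largest sublinear minorant [r] of
    [q] with [r (- k) <= - q k] for every [k] in [K]: indeed [r x <= r (x + k) + r (- k)]. *)
Definition envelope q K (x : V) : R := inf [set q (x + k) - q k | k in K].

Section Envelope.
Variables (L K : set V) (q : V -> R).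
Hypotheses (Ls : submodule L) (qs : sublinear_on L q) (KL : K `<=` L)
  (K0 : K 0) (KD : forall x y, K x -> K y -> K (x + y))
  (KZ : forall (a : R) x, 0 < a -> K x -> K (a *: x))
  (qK : forall x y, K x -> K y -> q (x + y) = q x + q y).

Lemma envelope_le x k : L x -> K k -> envelope q K x <= q (x + k) - q k.
Proof.
move=> Lx Kk; apply: ge_inf; last by exists k.
(* Subadditivity at [l = (x + l) + (- x)] bounds the increments from below, so the infimum is a
   genuine one. *)
exists (- q (- x)) => _ [l Kl <-]; have [_ LD _] := Ls.
have := qs.1 (x + l) (- x) (LD _ _ Lx (KL Kl)) (submoduleN Ls Lx).
rewrite addrAC subrr add0r => ?; lra.
Qed.

Lemma le_envelope x c : (forall k, K k -> c <= q (x + k) - q k) ->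
  c <= envelope q K x.
Proof.
move=> cx; apply: lb_le_inf; first by exists (q (x + 0) - q 0), 0.
by move=> _ [k Kk <-]; exact: cx.
Qed.

Lemma envelope_le_id x : L x -> envelope q K x <= q x.
Proof.
move=> Lx; apply: le_trans (envelope_le Lx K0) _.
by rewrite addr0 (sublinear_on0 Ls qs) subr0.
Qed.

(** For subadditivity, the infimum at [x + y] is tested on [k + l], where additivity of [q] on [K]
    splits the subtracted term. For homogeneity, [k] is rescaled by [a]. *)
Lemma envelope_sublinear : sublinear_on L (envelope q K).
Proof.
have [_ LD LZ] := Ls; split=> [x y Lx Ly|a x a0 Lx].
  rewrite -lerBlDr; apply: le_envelope => k Kk.
  rewrite lerBlDl -lerBlDr; apply: le_envelope => l Kl.
  have := envelope_le (LD _ _ Lx Ly) (KD Kk Kl).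
  have := qs.1 (x + k) (y + l) (LD _ _ Lx (KL Kk)) (LD _ _ Ly (KL Kl)).
  rewrite addrACA (qK Kk Kl) => ? ?; lra.
rewrite mulrC -ler_pdivrMr//; apply: le_envelope => k Kk.
rewrite ler_pdivrMr//; apply: le_trans (envelope_le (LZ _ _ Lx) (KZ a0 Kk)) _.
have Lk := KL Kk; have Lxk := LD _ _ Lx Lk.
rewrite -scalerDr !(sublinear_onZ Ls qs)//; lra.
Qed.

End Envelope.

(* A sublinear functional is linear as soon as it is minimal: otherwise its
   envelope along some ray would be strictly smaller. *)
Lemma minimal_sublinear_linear L q : submodule L -> sublinear_on L q ->
  (forall r, sublinear_on L r -> (forall x, L x -> r x <= q x) ->
    forall x, L x -> q x <= r x) -> linear_on L q.
Proof.
move=> Ls qs qmin; have [L0 LD LZ] := Ls.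
have q0 := sublinear_on0 Ls qs.
have qZ := sublinear_onZ Ls qs.
have qD x y : L x -> L y -> q (x + y) = q x + q y.
  move=> Lx Ly; apply/eqP; rewrite eq_le qs.1//=.
  pose K := [set z : V | exists2 t : R, 0 <= t & z = t *: y].
  have qKt t : 0 <= t -> q (t *: y) = t * q y.
    rewrite le_eqVlt => /orP[/eqP <-|t0]; last exact: qZ.
    by rewrite scale0r q0 mul0r.
  have KL : K `<=` L by move=> _ [t _ ->]; exact: LZ.
  have K0 : K 0 by exists 0 => //; rewrite scale0r.
  have KD a b : K a -> K b -> K (a + b).
    by move=> [s s0 ->] [t t0 ->]; exists (s + t); rewrite ?addr_ge0// scalerDl.
  have KZ (c : R) a : 0 < c -> K a -> K (c *: a).
    by move=> c0 [t t0 ->]; exists (c * t); rewrite ?scalerA// mulr_ge0// ltW.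
  have qK a b : K a -> K b -> q (a + b) = q a + q b.
    move=> [s s0 ->] [t t0 ->]; rewrite -scalerDl !qKt ?addr_ge0//; lra.
  have Ky : K y by exists 1 => //; rewrite scale1r.
  (* Minimality bounds [q x] by the envelope at [x], which is at most [q (x + y) - q y]; this is
     superadditivity. *)
  have := qmin _ (envelope_sublinear Ls qs KL K0 KD KZ qK)
    (envelope_le_id Ls qs KL K0) _ Lx.
  have := envelope_le Ls qs KL Lx Ky.
  lra.
have qN x : L x -> q (- x) = - q x.
  move=> Lx; have := qD x (- x) Lx (submoduleN Ls Lx).
  by rewrite subrr q0 => ?; lra.
have qZr (a : R) x : L x -> q (a *: x) = a * q x.
  move=> Lx; have [a0|a0|->] := ltgtP a 0.
  - rewrite -[a]opprK scaleNr qN ?qZ ?oppr_gt0//; [lra | exact: LZ].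
  - exact: qZ.
  - by rewrite scale0r q0 mul0r.
move=> a b x y Lx Ly; rewrite qD ?qZr//; exact: LZ.
Qed.

(** Zorn's lemma on the sublinear functionals below [p], in the reversed pointwise order on [L], so
    that a maximal element is a minimal functional. The upper bound of a chain is its pointwise
    infimum. *)
Lemma exists_linear_below L p : submodule L -> sublinear_on L p ->
  exists phi, linear_on L phi /\ forall x, L x -> phi x <= p x.
Proof.
move=> Ls ps; have [L0 LD LZ] := Ls.
pose T := {q : V -> R | sublinear_on L q /\ forall x, L x -> q x <= p x}.
pose below (q r : T) := `[< forall x, L x -> sval r x <= sval q x >].
pose p0 : T := exist _ p (conj ps (fun x _ => lexx (p x))).
(* A lower bound common to all candidates keeps the infimum of a nonempty chain finite. *)
have lowT (q : T) x : L x -> - p (- x) <= sval q x.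
  case: q => q /= [qs qp] Lx; have := sublinear_onN Ls qs Lx.
  have := qp _ (submoduleN Ls Lx); lra.
have [||A Atot|q qmax] := @ZL_preorder T p0 below.
- by move=> q; apply/asboolP.
- move=> q r s /asboolP qr /asboolP rs; apply/asboolP => x Lx.
  exact: le_trans (rs _ Lx) (qr _ Lx).
- have [->|/set0P[q0 Aq0]] := eqVneq A set0; first by exists p0.
  pose i x := inf [set sval q x | q in A].
  have i_le (q : T) x : A q -> L x -> i x <= sval q x.
    move=> Aq Lx; apply: ge_inf; last by exists q.
    by exists (- p (- x)) => _ [r _ <-]; exact: lowT.
  have le_i c x : (forall q : T, A q -> c <= sval q x) -> c <= i x.
    move=> cq; apply: lb_le_inf; first by exists (sval q0 x), q0.
    by move=> _ [r Ar <-]; exact: cq.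
  have is_ : sublinear_on L i.
    split=> [x y Lx Ly|a x a0 Lx].
      rewrite -lerBlDr; apply: (le_i) => q Aq.
      rewrite lerBlDl -lerBlDr; apply: (le_i) => r Ar.
      (* The smaller of the two members of the chain serves for both terms. *)
      have [/asboolP/(_ x Lx) h|/asboolP/(_ y Ly) h] := Atot _ _ Aq Ar.
      + have := (svalP r).1.1 x y Lx Ly; have := i_le _ _ Ar (LD _ _ Lx Ly); lra.
      + have := (svalP q).1.1 x y Lx Ly; have := i_le _ _ Aq (LD _ _ Lx Ly); lra.
    rewrite mulrC -ler_pdivrMr//; apply: (le_i) => q Aq; rewrite ler_pdivrMr// mulrC.
    exact: le_trans (i_le _ _ Aq (LZ _ _ Lx)) ((svalP q).1.2 _ _ a0 Lx).
  have ip x : L x -> i x <= p x.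
    by move=> Lx; exact: le_trans (i_le _ _ Aq0 Lx) ((svalP q0).2 _ Lx).
  exists (exist _ i (conj is_ ip)) => q Aq; apply/asboolP => x Lx /=; exact: i_le.
exists (sval q); split; last exact: (svalP q).2.
apply: minimal_sublinear_linear => //; first exact: (svalP q).1.
move=> r rs rq; have rp x : L x -> r x <= p x.
  by move=> Lx; exact: le_trans (rq _ Lx) ((svalP q).2 _ Lx).
have /asboolP := qmax (exist _ r (conj rs rp)) (introT (asboolP _) rq).
by [].
Qed.

(** A linear [phi] below the envelope of [p] along [K] satisfies [phi (- k) <= p 0 - p k], that is
    [p k <= phi k]; the other inequality holds on all of [L]. *)
Lemma hahn_banach_cone L K p : submodule L -> sublinear_on L p -> K `<=` L ->
  K 0 -> (forall x y, K x -> K y -> K (x + y)) ->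
  (forall (a : R) x, 0 < a -> K x -> K (a *: x)) ->
  (forall x y, K x -> K y -> p (x + y) = p x + p y) ->
  exists phi, [/\ linear_on L phi, (forall x, L x -> phi x <= p x) &
    (forall k, K k -> phi k = p k)].
Proof.
move=> Ls ps KL K0 KD KZ pK.
have [phi [phil phip]] := exists_linear_below Ls
  (envelope_sublinear Ls ps KL K0 KD KZ pK).
have phi_p x : L x -> phi x <= p x.
  move=> Lx; exact: le_trans (phip _ Lx) (envelope_le_id Ls ps KL K0 Lx).
exists phi; split=> // k Kk; apply/eqP; rewrite eq_le phi_p /=; last exact: KL.
have Lk := KL _ Kk; have LNk := submoduleN Ls Lk.
have := le_trans (phip _ LNk) (envelope_le Ls ps KL LNk Kk).
rewrite addNr (sublinear_on0 Ls ps).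
have := phil (-1) 0 k k Lk Lk; rewrite scaleN1r scale0r addr0 => ->; lra.
Qed.

End HahnBanach.

(** * Dunford-Schwartz integration for a finitely additive set function *)

Section Integral.
Variables (R : realType) (Omega : Type) (m : set Omega -> R).
Hypotheses (m_ge0 : forall A, 0 <= m A)
  (mU : forall A B, A `&` B = set0 -> m (A `|` B) = m A + m B).
Implicit Types (f g : Omega -> R) (A B : set Omega).

Lemma finadd0 : m set0 = 0.
Proof. by have := mU (setI0 set0); rewrite setU0 => ?; lra. Qed.

Lemma finadd_le A B : A `<=` B -> m A <= m B.
Proof. by move=> AB; rewrite -(setDUK AB) mU ?setDIK// lerDl. Qed.

Lemma finaddU_le A B : m (A `|` B) <= m A + m B.
Proof.
rewrite -(setDUK (@subsetUl _ A B)).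
rewrite mU ?setDIK// lerD2l; apply: finadd_le.
by move=> x [[]].
Qed.

Lemma finadd_preimage (T : eqType) (h : Omega -> T) (s : seq T) : uniq s ->
  m (h @^-1` [set` s]) = \sum_(z <- s) m (h @^-1` [set z]).
Proof.
elim: s => [_|z s IH /= /andP[zs us]].
  by rewrite big_nil (_ : _ @^-1` _ = set0) ?finadd0//; apply/seteqP; split.
rewrite big_cons -IH// -mU.
  congr m; apply/seteqP; split=> x /=; rewrite in_cons.
    by move/orP=> [/eqP|]; [left|right].
  by move=> [->|->]; rewrite ?eqxx ?orbT.
by apply/seteqP; split=> x //= [hx]; rewrite hx (negPf zs).
Qed.

(** Regroups the sum over values along the fibres of [h]. With [h] the pair of two simple functions,
    both are integrated over one common partition, which makes linearity and monotonicity
    termwise. *)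
Lemma sint_comp (T : eqType) (h : Omega -> T) (G : T -> R) (s : seq T) :
  uniq s -> (forall x, h x \in s) ->
  sint m (fun x => G (h x)) = \sum_(z <- s) G z * m (h @^-1` [set z]).
Proof.
move=> us hs.
have rangeG : range (fun x => G (h x)) `<=` [set` map G s].
  by move=> _ [x _ <-] /=; exact: map_f.
have fin : finite_set (range (fun x => G (h x))).
  exact: sub_finite_set rangeG (finite_seq _).
rewrite /sint fsbig_finite//; set D := fset_set _.
under eq_bigr => r _.
  (* The level set of the composite at [r] is the disjoint union of the fibres of [h] over the [z]
     with [G z = r]. *)
  rewrite (_ : _ @^-1` _ = h @^-1` [set` [seq z <- s | G z == r]]); last first.
    apply/seteqP; split=> x /=; rewrite mem_filter hs andbT.
      by move=> ->; rewrite eqxx.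
    by move/eqP.
  rewrite finadd_preimage ?filter_uniq// big_filter mulr_sumr big_mkcond.
  over.
rewrite exchange_big /=; apply: eq_big_seq => z zs.
have [[x hx]|nz] := pselect (exists x, h x = z).
  rewrite (bigD1_seq (G z)) ?fset_uniq//=; last first.
    have : [set` D] (G z) by rewrite /D fset_setK//; exists x => //; rewrite hx.
    by [].
  rewrite eqxx big1 ?addr0// => r; rewrite eq_sym => /negPf -> //.
(* If [h] never takes the value [z], then [G z] may lie outside the range, but the fibre is empty
   and both sides vanish. *)
have -> : h @^-1` [set z] = set0.
  by apply/seteqP; split=> x //= hx; apply: nz; exists x.
by rewrite finadd0 mulr0 big1// => r _; rewrite mulr0 if_same.
Qed.

Lemma simple_comp2 (G : R -> R -> R) f g : simple f -> simple g ->
  simple (fun x => G (f x) (g x)).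
Proof.
move=> sf sg; apply: sub_finite_set (finite_image (fun z => G z.1 z.2) (finite_setX sf sg)).
by move=> _ [x _ <-]; exists (f x, g x) => //=; split; exists x.
Qed.

Lemma simple_comp (G : R -> R) f : simple f -> simple (fun x => G (f x)).
Proof. by move=> sf; exact: (simple_comp2 (fun x _ => G x) sf sf). Qed.

Lemma simple_common_range f g : simple f -> simple g ->
  exists s : seq (R * R), uniq s /\
    [set` s] = range (fun x => (f x, g x)).
Proof.
move=> sf sg; have fin : finite_set (range (fun x => (f x, g x))).
  apply: sub_finite_set (finite_setX sf sg).
  by move=> _ [x _ <-]; split; exists x.
by exists (fset_set (range (fun x => (f x, g x)))); rewrite fset_uniq fset_setK.
Qed.

Lemma sint_lin (a b : R) f g : simple f -> simple g ->
  sint m (fun x => a * f x + b * g x) = a * sint m f + b * sint m g.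
Proof.
move=> sf sg; have [s [us rs]] := simple_common_range sf sg.
have hs x : (f x, g x) \in s.
  by have : [set` s] (f x, g x) by rewrite rs; exists x.
rewrite (@sint_comp _ _ (fun z => a * z.1 + b * z.2) s us hs).
rewrite (@sint_comp _ _ (fun z => z.1) s us hs).
rewrite (@sint_comp _ _ (fun z => z.2) s us hs).
rewrite !mulr_sumr -big_split/=; apply: eq_bigr => z _; ring.
Qed.

Lemma sint_le f g : simple f -> simple g -> (forall x, f x <= g x) ->
  sint m f <= sint m g.
Proof.
move=> sf sg fg; have [s [us rs]] := simple_common_range sf sg.
have hs x : (f x, g x) \in s.
  by have : [set` s] (f x, g x) by rewrite rs; exists x.
rewrite (@sint_comp _ _ (fun z => z.1) s us hs).
rewrite (@sint_comp _ _ (fun z => z.2) s us hs).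
rewrite !big_seq; apply: ler_sum => z zs.
have : [set` s] z by [].
by rewrite rs => -[x _ <-] /=; rewrite ler_wpM2r.
Qed.

Lemma simple_ind A : simple (@ind R Omega A).
Proof.
apply: (@sub_finite_set _ _ [set` [:: 1; 0 : R]]); last exact: finite_seq.
by move=> _ [x _ <-] /=; rewrite /ind !inE; case: ifP; rewrite eqxx ?orbT.
Qed.

Lemma sint_ind A : sint m (ind R A) = m A.
Proof.
have := @sint_comp _ (fun x => `[< A x >]) (fun b : bool => if b then 1 else 0)
  [:: true; false] isT.
rewrite /ind => ->; last by move=> x; case: `[< _ >].
rewrite big_cons big_seq1 mul1r mul0r addr0; congr m.
by apply/seteqP; split=> x /=; move/asboolP.
Qed.

Lemma indT x : @ind R Omega setT x = 1.
Proof. by rewrite /ind asboolT. Qed.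

Lemma simple_cst (c : R) : simple (fun _ : Omega => c).
Proof. exact: (simple_comp (fun _ => c) (simple_ind set0)). Qed.

Lemma sint_cst (c : R) : sint m (fun _ => c) = c * m setT.
Proof.
have := sint_lin c 0 (simple_ind setT) (simple_ind setT).
rewrite sint_ind mul0r addr0 => <-; congr sint; apply/funext => x.
by rewrite indT mul0r addr0 mulr1.
Qed.

Lemma sintB f g : simple f -> simple g ->
  sint m (fun x => f x - g x) = sint m f - sint m g.
Proof.
move=> sf sg; have := sint_lin 1 (-1) sf sg; rewrite mul1r mulN1r => <-.
by congr sint; apply/funext => x; rewrite mul1r mulN1r.
Qed.

Lemma le_abs_sint f : simple f -> `|sint m f| <= sint m (fun x => `|f x|).
Proof.
move=> sf; have sa := simple_comp (fun y => `|y|) sf.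
rewrite ler_norml; apply/andP; split; last by apply: sint_le => // x; exact: ler_norm.
have := sintB (simple_cst 0) sa; rewrite sint_cst mul0r sub0r => <-.
apply: sint_le => //; first exact: (simple_comp (fun y => 0 - `|y|)).
by move=> x; rewrite sub0r lerNl -normrN; exact: ler_norm.
Qed.

Lemma simple_bounded f : simple f -> exists2 M, 0 <= M & forall x, `|f x| <= M.
Proof.
move=> sf; exists (\sum_(r <- fset_set (range f)) `|r|); first exact: sumr_ge0.
move=> x; rewrite (bigD1_seq (f x)) ?fset_uniq//=; last first.
  have : [set` fset_set (range f)] (f x) by rewrite fset_setK//; exists x.
  by [].
by rewrite lerDl sumr_ge0.
Qed.

Lemma cvg_seqP (u : nat -> R) (l : R) : u @ \oo --> l <->
  forall e, 0 < e -> exists N, forall n, (N <= n)%N -> `|u n - l| < e.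
Proof.
split=> [/cvgrPdist_lt h e /h[N _ HN]|h].
  by exists N => n Nn; rewrite distrC; exact: HN.
apply/cvgrPdist_lt => e /h[N HN]; exists N => // n /= Nn.
by rewrite distrC; exact: HN.
Qed.

(* Cauchy in mean plus convergence in measure to 0: beyond some index N the
   integral of |s n| is that of |s n - s N|, plus the bound of s N times the
   measure of {|s n| > d}, plus d m(Omega). *)
Lemma determining0_cvg s : determining m (fun _ => 0) s ->
  (fun n => sint m (fun x => `|s n x|)) @ \oo --> (0 : R).
Proof.
move=> [ss smeas scau]; apply/cvg_seqP => e e0.
have e3 : 0 < e / 3 by rewrite divr_gt0.
have [N HN] := scau _ e3.
have [M M0 HM] := simple_bounded (ss N).
have mT0 : 0 < m setT + 1 by rewrite ltr_wpDl.
have M1 : 0 < M + 1 by rewrite ltr_wpDl.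
(* The added 1 keeps the denominators positive; [d * m setT] and [M * d'] are then at most
   [e / 3]. *)
pose d := e / 3 / (m setT + 1).
have d0 : 0 < d by rewrite divr_gt0.
have dE : d * (m setT + 1) = e / 3 by rewrite divfK ?gt_eqF.
pose d' := e / 3 / (M + 1).
have d'0 : 0 < d' by rewrite divr_gt0.
have d'E : d' * (M + 1) = e / 3 by rewrite divfK ?gt_eqF.
have /cvg_seqP/(_ d' d'0)[N' HN'] := smeas _ d0.
exists (maxn N N') => n; rewrite geq_max => /andP[Nn N'n].
have sN := simple_comp (fun y => `|y|) (ss n).
rewrite subr0 ger0_norm; last first.
  exact: le_trans (normr_ge0 _) (le_abs_sint (ss n)).
pose A := [set x | d < `|s n x - 0|].
have mA : m A < d'.
  by have := HN' _ N'n; rewrite subr0 ger0_norm.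
have sd : simple (fun x => `|s n x - s N x|).
  exact: (simple_comp2 (fun y z => `|y - z|)).
have sAd : simple (fun x => M * ind R A x + d * ind R setT x).
  exact: (simple_comp2 (fun y z => M * y + d * z) (simple_ind A) (simple_ind setT)).
have sAll : simple (fun x => 1 * `|s n x - s N x| + 1 * (M * ind R A x + d * ind R setT x)).
  exact: (simple_comp2 (fun y z => 1 * y + 1 * z) sd sAd).
have H : sint m (fun x => `|s n x|) <=
    sint m (fun x => 1 * `|s n x - s N x| + 1 * (M * ind R A x + d * ind R setT x)).
  apply: sint_le => // x; rewrite indT /ind.
  case: asboolP => /=; rewrite /A/=.
    have := ler_normD (s n x - s N x) (s N x); rewrite subrK => *.
    have := HM x; lra.
  move/negP; rewrite subr0 -leNgt => *; have := normr_ge0 (s n x - s N x); lra.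
apply: le_lt_trans H _; rewrite !sint_lin//; try exact: simple_ind.
rewrite !sint_ind; have := HN _ _ Nn (leqnn N).
have : M * m A <= M * d' by rewrite ler_wpM2l// ltW.
lra.
Qed.

(** A deviation of [G] beyond [e] forces one argument to deviate beyond [e / (2 * c)], which gives
    convergence in measure; integrating the Lipschitz bound gives the Cauchy property in mean.
    Differences, linear combinations and truncations are all instances. *)
Lemma determining_lip (G : R -> R -> R) (c : R) f g s t : 0 < c ->
  (forall x y x' y', `|G x y - G x' y'| <= c * (`|x - x'| + `|y - y'|)) ->
  determining m f s -> determining m g t ->
  determining m (fun x => G (f x) (g x)) (fun n x => G (s n x) (t n x)).
Proof.
move=> c0 Glip [ss smeas scau] [st tmeas tcau]; split.
- by move=> n; exact: simple_comp2.
- move=> e e0; apply/cvg_seqP => d d0.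
  have d2 : 0 < d / 2 by rewrite divr_gt0.
  have ec : 0 < e / (2 * c) by rewrite divr_gt0// mulr_gt0.
  have ecE : e / (2 * c) * (2 * c) = e by rewrite divfK// gt_eqF// mulr_gt0.
  have /cvg_seqP/(_ _ d2)[N1 HN1] := smeas _ ec.
  have /cvg_seqP/(_ _ d2)[N2 HN2] := tmeas _ ec.
  exists (maxn N1 N2) => n; rewrite geq_max => /andP[/HN1 + /HN2].
  rewrite !subr0 !ger0_norm// => h1 h2; rewrite (splitr d).
  apply: le_lt_trans (ltrD h1 h2); apply: le_trans (finaddU_le _ _).
  apply: finadd_le => x /= ex; apply/orP; rewrite -implyNb; apply/implyP.
  rewrite -leNgt => h; rewrite ltNge; apply/negP => h'.
  have := Glip (s n x) (t n x) (f x) (g x).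
  have : c * (`|s n x - f x| + `|t n x - g x|) <= c * (2 * (e / (2 * c))).
    by rewrite ler_wpM2l ?(ltW c0)//; lra.
  move: ex; lra.
- move=> e e0.
  have ec : 0 < e / (2 * c) by rewrite divr_gt0// mulr_gt0.
  have ecE : e / (2 * c) * (2 * c) = e by rewrite divfK// gt_eqF// mulr_gt0.
  have [N1 HN1] := scau _ ec; have [N2 HN2] := tcau _ ec.
  exists (maxn N1 N2) => n k; rewrite !geq_max => /andP[n1 n2] /andP[k1 k2].
  have := HN1 _ _ n1 k1; have := HN2 _ _ n2 k2.
  have s1 : simple (fun x => `|s n x - s k x|).
    exact: (simple_comp2 (fun y z => `|y - z|)).
  have s2 : simple (fun x => `|t n x - t k x|).
    exact: (simple_comp2 (fun y z => `|y - z|)).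
  have : sint m (fun x => `|G (s n x) (t n x) - G (s k x) (t k x)|) <=
      sint m (fun x => c * `|s n x - s k x| + c * `|t n x - t k x|).
    apply: sint_le.
    + by apply: (simple_comp2 (fun y z => `|y - z|)); exact: simple_comp2.
    + exact: (simple_comp2 (fun y z => c * y + c * z)).
    + by move=> x; rewrite -mulrDr; exact: Glip.
  rewrite sint_lin// => h h1 h2; apply: le_lt_trans h _.
  rewrite -mulrDr -ltr_pdivlMl// mulrC -ecE mulrA mulfK ?gt_eqF//; lra.
Qed.

Lemma determining_is_cvg f s : determining m f s -> cvgn (fun n => sint m (s n)).
Proof.
move=> [ss _ scau]; apply/cauchy_cvgP; apply/cauchy_ballP => e e0; near_simpl.
have [N HN] := scau _ e0.
exists ([set n | (N <= n)%N], [set n | (N <= n)%N]); first by split; exists N.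
move=> [n k] [/= Nn Nk]; rewrite /ball /= -sintB//.
apply: le_lt_trans (le_abs_sint _) (HN _ _ Nn Nk).
exact: (simple_comp2 (fun y z => y - z)).
Qed.

(** The difference of two determining sequences of [f] determines 0, so its integrals tend to 0. *)
Lemma is_DSint_uniq f v w : is_DSint m f v -> is_DSint m f w -> v = w.
Proof.
move=> [s [ds sv]] [t [dt tw]].
have d0 : determining m (fun _ => 0) (fun n x => s n x - t n x).
  have -> : (fun=> 0) = (fun x => f x - f x) by apply/funext => x; rewrite subrr.
  apply: (@determining_lip (fun y z => y - z) 1) => // x y x' y'.
  have -> : x - y - (x' - y') = (x - x') - (y - y') by ring.
  by rewrite mul1r ler_normB.
have h1 : (fun n => sint m (s n) - sint m (t n)) @ \oo --> (0 : R).
  apply/cvg_seqP => e e0; have /cvg_seqP/(_ _ e0)[N HN] := determining0_cvg d0.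
  exists N => n /HN; rewrite !subr0; apply: le_lt_trans.
  have [ss _ _] := ds; have [st _ _] := dt.
  rewrite -sintB//; apply: le_trans (ler_norm _); apply: le_abs_sint.
  exact: (simple_comp2 (fun y z => y - z)).
have h2 : (fun n => sint m (s n) - sint m (t n)) @ \oo --> v - w by exact: cvgB.
apply/eqP; rewrite -subr_eq0; apply/eqP.
exact: (cvg_unique (@Rhausdorff R) h2 h1).
Qed.

Lemma DSintE f v : is_DSint m f v -> DSint m f = v.
Proof. by move=> fv; apply: xget_subset1 => // u w; exact: is_DSint_uniq. Qed.

Lemma is_DSint_lin (a b : R) f g u v : is_DSint m f u -> is_DSint m g v ->
  is_DSint m (fun x => a * f x + b * g x) (a * u + b * v).
Proof.
move=> [s [ds su]] [t [dt tv]].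
exists (fun n x => a * s n x + b * t n x); split.
  (* The added 1 keeps the Lipschitz constant positive when [a = b = 0]. *)
  apply: (@determining_lip (fun y z => a * y + b * z) (`|a| + `|b| + 1)) => //.
  move=> x y x' y'.
  have -> : a * x + b * y - (a * x' + b * y') = a * (x - x') + b * (y - y') by ring.
  apply: le_trans (ler_normD _ _) _; rewrite !normrM.
  have := normr_ge0 a; have := normr_ge0 b.
  have := normr_ge0 (x - x'); have := normr_ge0 (y - y'); nra.
have [ss _ _] := ds; have [st _ _] := dt.
under eq_fun do rewrite sint_lin//.
by apply: cvgD; apply: cvgM => //; exact: cvg_cst.
Qed.

(** The scalar function behind [trunc]: [trunc n f x] is convertible to [clip n (f x)]. *)
Definition clip (n : nat) (y : R) : R :=
  Num.min (Num.max y 0) n%:R - Num.min (Num.max (- y) 0) n%:R.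

Lemma clipE n y : clip n y = Num.max (- n%:R) (Num.min y n%:R).
Proof.
have n0 : 0 <= n%:R :> R by [].
rewrite /clip !minEle !maxEle; repeat case: ifPn; rewrite -?ltNge; lra.
Qed.

Lemma clip_lip n (y z : R) : `|clip n y - clip n z| <= `|y - z|.
Proof.
have n0 : 0 <= n%:R :> R by [].
rewrite !clipE !minEle !maxEle; have := ler_norm (y - z).
have := ler_norm (z - y); rewrite distrC ler_norml => ? ?.
repeat case: ifPn; rewrite -?ltNge; lra.
Qed.

Lemma clip_id n (y : R) : `|y| <= n%:R -> clip n y = y.
Proof.
rewrite ler_norml => /andP[? ?]; rewrite clipE !minEle !maxEle.
repeat case: ifPn; rewrite -?ltNge; lra.
Qed.

Lemma nat_above (M : R) : exists N, forall n, (N <= n)%N -> M <= n%:R.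
Proof.
exists (Num.truncn M).+1 => n Nn; apply: le_trans (ltW (truncnS_gt M)) _.
by rewrite ler_nat.
Qed.

(** Once [n] exceeds a bound of [s N], clipping at [n] fixes [s N]; being 1-Lipschitz, it then
    changes the integral of [s k] by at most twice the integral of [|s k - s N|], uniformly in
    [n]. *)
Lemma cvg_DSint_trunc f v : is_DSint m f v ->
  (fun n => DSint m (trunc n f)) @ \oo --> v.
Proof.
move=> [s [ds sv]].
have dn n : determining m (trunc n f) (fun k x => clip n (s k x)).
  apply: (@determining_lip (fun y _ => clip n y) 1 f f s s) => // x y x' y'.
  by rewrite mul1r (le_trans (clip_lip _ _ _))// lerDl.
have DSn n := DSintE (ex_intro _ _ (conj (dn n) (determining_is_cvg (dn n)))).
have [ss _ scau] := ds.
(* One quarter for each of the two limits in [k], two quarters for the clipping of [s k]. *)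
apply/cvg_seqP => e e0; have e4 : 0 < e / 4 by rewrite divr_gt0.
have [N HN] := scau _ e4; have [M _ HM] := simple_bounded (ss N).
have [K HK] := nat_above M.
exists K => n /HK Mn; rewrite DSn; set w := lim _.
have /cvg_seqP/(_ _ e4)[N1 HN1] := determining_is_cvg (dn n).
have /cvg_seqP/(_ _ e4)[N2 HN2] := sv.
pose k := maxn N (maxn N1 N2).
have /HN1 h1 : (N1 <= k)%N by rewrite /k !leq_max leqnn orbT.
have /HN2 h2 : (N2 <= k)%N by rewrite /k !leq_max leqnn !orbT.
have Nk : (N <= k)%N by rewrite leq_maxl.
have h3 := HN _ _ Nk (leqnn N).
have sc : simple (fun x => clip n (s k x)) by exact: simple_comp.
have sd : simple (fun x => `|s k x - s N x|).
  exact: (simple_comp2 (fun y z => `|y - z|)).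
have h4 : `|sint m (fun x => clip n (s k x)) - sint m (s k)| <=
    2 * sint m (fun x => `|s k x - s N x|).
  rewrite -sintB//; apply: le_trans (le_abs_sint _) _.
    exact: (simple_comp2 (fun y z => y - z)).
  have := sint_lin 2 0 sd sd; rewrite mul0r addr0 => <-; apply: sint_le.
  - exact: (simple_comp2 (fun y z => `|y - z|)).
  - exact: (simple_comp2 (fun y z => 2 * y + 0 * z)).
  - move=> x; have := clip_lip n (s k x) (s N x).
    rewrite [clip n (s N x)]clip_id; last exact: le_trans (HM x) Mn.
    have := ler_normD (clip n (s k x) - s N x) (s N x - s k x).
    rewrite addrA subrK (distrC (s N x)); lra.
have := ler_normD (w - sint m (fun x => clip n (s k x)))
  (sint m (fun x => clip n (s k x)) - v).
rewrite addrA subrK (distrC w (sint _ _)); rewrite -/w in h1.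
have := ler_normD (sint m (fun x => clip n (s k x)) - sint m (s k))
  (sint m (s k) - v).
rewrite addrA subrK; lra.
Qed.

(** The truncated integrals converge to [v], so the default value [+oo] of [pint] is not taken. *)
Lemma pintE f v : is_DSint m f v -> pint m f = v%:E.
Proof.
move=> /cvg_DSint_trunc fv; apply: xget_subset1.
  by apply: cvg_EFin => //; near=> n.
exact: cvg_unique (@ereal_hausdorff R) _ _.
Unshelve. all: by end_near. Qed.

End Integral.

(** Rounding [f + M] down to a multiple of [e] leaves finitely many values, since
    [0 <= f + M <= 2 * M]. *)
Lemma bounded_simple_approx (R : realType) (Omega : Type) (f : Omega -> R) (M e : R) :
  (forall x, `|f x| <= M) -> 0 < e ->
  exists s, simple s /\ forall x, `|s x - f x| <= e.
Proof.
move=> fM e0; pose k x := Num.truncn ((f x + M) / e).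
have k0 x : 0 <= (f x + M) / e.
  by rewrite divr_ge0 ?(ltW e0)//; have := fM x; rewrite ler_norml => /andP[]; lra.
exists (fun x => e * (k x)%:R - M); split=> [|x]; last first.
  have /andP[] := truncn_itv (k0 x); rewrite -/(k x) ler_pdivlMr// ltr_pdivrMr//.
  by rewrite -natr1 ler_norml => *; apply/andP; split; lra.
have [N HN] := nat_above (2 * M / e).
apply: sub_finite_set (finite_image (fun j : nat => e * j%:R - M) (finite_II N.+1)).
move=> _ [x _ <-]; exists (k x) => //=.
rewrite ltnS -(ler_nat R) (le_trans _ (HN N (leqnn N)))//.
have /andP[kx _] := truncn_itv (k0 x); apply: le_trans kx _.
by rewrite ler_pM2r ?invr_gt0//; have := fM x; rewrite ler_norml => /andP[]; lra.
Qed.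

(** * The order [ge] and the lattice [L] *)

Section StarOrder.
Variables (R : realType) (Omega : Type) (ge : (Omega -> R) -> (Omega -> R) -> Prop).
Hypothesis Hge : star_order ge.
Implicit Types f g : Omega -> R.

Lemma star_order_of_le f g : (forall x, g x <= f x) -> ge f g.
Proof.
move=> gf; have [refl _ [_ cone cert _ _]] := Hge.
have fg : ge (fun x => f x - g x) (fun _ => 0).
  by apply: cert => x; rewrite subr_ge0.
have := cone _ _ _ _ 1 1 fg (refl g) ler01 ler01.
rewrite (_ : (fun x => _) = f); last by apply/funext => x; ring.
by rewrite (_ : (fun x => _) = g)//; apply/funext => x; ring.
Qed.

Lemma bounded_star_of_bounded f (M : R) : (forall x, `|f x| <= M) -> bounded_star ge f.
Proof.
move=> fM; exists (`|M| + 1); split; first by rewrite ltr_wpDl.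
by apply: star_order_of_le => x; have := fM x; have := ler_norm M; lra.
Qed.

(** REST, applied to [eta - |f|] on the set where [|f| > eta], says that minus the excess dominates
    0; adding the excess to both sides concludes. *)
Lemma bounded_star_excess f (eta : R) : ge (fun _ => eta) (fun x => `|f x|) ->
  ge (fun _ => 0) (fun x => Num.max (`|f x| - eta) 0).
Proof.
move=> fe; have [refl _ [_ cone _ _ rest]] := Hge.
have h1 : ge (fun x => eta - `|f x|) (fun _ => 0).
  have := cone _ _ _ _ 1 1 fe (refl (fun x => - `|f x|)) ler01 ler01.
  rewrite (_ : (fun x => _) = (fun x => eta - `|f x|)); last by apply/funext => x; ring.
  by rewrite (_ : (fun x => 1 * `|f x| + _) = (fun=> 0))//; apply/funext => x; ring.
have h2 := rest _ [set x | eta < `|f x|] h1.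
have := cone _ _ _ _ 1 1 h2 (refl (fun x => Num.max (`|f x| - eta) 0)) ler01 ler01.
rewrite (_ : (fun x => 1 * (_ * _) + _) = (fun=> 0)); last first.
  apply/funext => x; rewrite /ind maxEle; case: asboolP => /=.
    by case: ifPn; rewrite -?ltNge; lra.
  by move/negP; rewrite -leNgt; case: ifPn; rewrite -?ltNge; lra.
rewrite (_ : (fun x => 1 * 0 + _) = (fun x => Num.max (`|f x| - eta) 0))//.
by apply/funext => x; ring.
Qed.

Variables (L : set (Omega -> R)).
Hypotheses (HL : vector_lattice L) (HBL : bounded_star ge `<=` L).

Lemma L_lin (a b : R) f g : L f -> L g -> L (fun x => a * f x + b * g x).
Proof. by have [_ LD LZ _ _] := HL => Lf Lg; apply: LD; exact: LZ. Qed.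

Lemma L_bounded f (M : R) : (forall x, `|f x| <= M) -> L f.
Proof. by move=> fM; apply: HBL; exact: bounded_star_of_bounded fM. Qed.

Lemma L_cst (c : R) : L (fun _ => c).
Proof. exact: (@L_bounded _ `|c|). Qed.

Lemma L_sub f g : L f -> L g -> L (fun x => f x - g x).
Proof.
move=> Lf Lg; have := L_lin 1 (-1) Lf Lg.
by under eq_fun do rewrite mul1r mulN1r.
Qed.

Lemma L_abs f : L f -> L (fun x => `|f x|).
Proof.
move=> Lf; have [_ _ LZ Lmax _] := HL.
have := Lmax _ _ Lf (LZ (-1) _ Lf).
by under eq_fun do rewrite mulN1r maxrN.
Qed.

Lemma L_simple f : simple f -> L f.
Proof. by move=> /simple_bounded[M _ fM]; exact: L_bounded fM. Qed.

Lemma L_trunc n f : L f -> L (trunc n f).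
Proof.
move=> Lf; have [_ _ LZ Lmax Lmin] := HL; apply: L_sub.
  by apply: (Lmin _ _ _ (L_cst n%:R)); exact: Lmax _ _ Lf (L_cst 0).
apply: (Lmin (fun x => Num.max (- f x) 0) _ _ (L_cst n%:R)).
apply: (Lmax (fun x => - f x) _ _ (L_cst 0)).
by have := LZ (-1) _ Lf; under eq_fun do rewrite mulN1r.
Qed.

(** * The set function and the integral induced by a monotone linear functional *)

Section Functional.
Variable phi : (Omega -> R) -> R.
Hypotheses
  (phi_lin : forall (a b : R) f g, L f -> L g ->
     phi (fun x => a * f x + b * g x) = a * phi f + b * phi g)
  (phi_mono : forall f g, L f -> L g -> ge f g -> phi g <= phi f).

Let m (A : set Omega) : R := phi (ind R A).

Lemma phi_le f g : L f -> L g -> (forall x, f x <= g x) -> phi f <= phi g.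
Proof. by move=> Lf Lg fg; apply: phi_mono => //; exact: star_order_of_le. Qed.

Lemma phi_cst (c : R) : phi (fun _ => c) = c * phi (fun _ => 1).
Proof.
have -> : (fun=> c) = (fun _ : Omega => c * 1 + 0 * 1) by apply/funext => x; ring.
by rewrite (phi_lin c 0 (L_cst 1) (L_cst 1)); ring.
Qed.

Lemma phi0 : phi (fun _ => 0) = 0.
Proof. by rewrite phi_cst mul0r. Qed.

Lemma phiB f g : L f -> L g -> phi (fun x => f x - g x) = phi f - phi g.
Proof.
move=> Lf Lg; have := phi_lin 1 (-1) Lf Lg; rewrite mul1r mulN1r => <-.
by congr phi; apply/funext => x; ring.
Qed.

Lemma phi_dist f g k : L f -> L g -> L k -> (forall x, `|f x - g x| <= k x) ->
  `|phi f - phi g| <= phi k.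
Proof.
move=> Lf Lg Lk fgk; rewrite ler_norml; apply/andP; split.
  rewrite lerNl opprB -phiB//; apply: phi_le => //; first exact: L_sub.
  by move=> x; have := fgk x; rewrite ler_norml => /andP[]; lra.
rewrite -phiB//; apply: phi_le => //; first exact: L_sub.
by move=> x; have := fgk x; rewrite ler_norml => /andP[].
Qed.

Lemma phi_ge0 f : L f -> (forall x, 0 <= f x) -> 0 <= phi f.
Proof. by move=> Lf f0; rewrite -phi0; apply: phi_le => //; exact: L_cst. Qed.

Lemma L_ind A : L (ind R A).
Proof. exact/L_simple/simple_ind. Qed.

Lemma ind_ge0 A x : 0 <= @ind R Omega A x.
Proof. by rewrite /ind; case: ifP. Qed.

Lemma phi_ind_ba : ba_star_plus ge m.
Proof.
split.
- by move=> A; apply: phi_ge0; [exact: L_ind|exact: ind_ge0].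
- exists (phi (fun _ => 1)) => A; apply: phi_le; [exact: L_ind|exact: L_cst|].
  by move=> x; rewrite /ind; case: ifP.
- move=> A B AB; have := phi_lin 1 1 (L_ind A) (L_ind B); rewrite !mul1r => <-.
  congr phi; apply/funext => x; rewrite /ind.
  have ABx : ~ (A x /\ B x) by move=> ABx; have : (A `&` B) x by []; rewrite AB.
  have [Ax|nAx] := pselect (A x); have [Bx|nBx] := pselect (B x).
  + by case: ABx.
  + have ABT : (A `|` B) x by left.
    by rewrite (asboolT ABT) (asboolT Ax) (asboolF nBx); ring.
  + have ABT : (A `|` B) x by right.
    by rewrite (asboolT ABT) (asboolF nAx) (asboolT Bx); ring.
  + have ABF : ~ (A `|` B) x by case.
    by rewrite (asboolF ABF) (asboolF nAx) (asboolF nBx); ring.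
(* Membership in [null_star] is a comparison in [ge], so the upper bound uses monotonicity for [ge]
   rather than for the pointwise order. *)
- move=> A nA; apply/eqP; rewrite eq_le; apply/andP; split.
    by rewrite -phi0; apply: phi_mono => //; [exact: L_cst|exact: L_ind].
  by apply: phi_ge0; [exact: L_ind|exact: ind_ge0].
Qed.

Let m_ge0 A : 0 <= m A. Proof. by have [] := phi_ind_ba. Qed.

Let mU A B : A `&` B = set0 -> m (A `|` B) = m A + m B.
Proof. by have [_ _ + _] := phi_ind_ba; apply. Qed.

Lemma phi_sum_ind (c : R -> R) (A : R -> set Omega) (s : seq R) :
  L (fun x => \sum_(r <- s) c r * ind R (A r) x) /\
  phi (fun x => \sum_(r <- s) c r * ind R (A r) x) = \sum_(r <- s) c r * m (A r).
Proof.
elim: s => [|r s [Ls IH]].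
  by under eq_fun do rewrite big_nil; rewrite big_nil phi0; split=> //; exact: L_cst.
rewrite big_cons -IH.
have -> : (fun x => \sum_(r <- r :: s) c r * ind R (A r) x) =
    (fun x => c r * ind R (A r) x + 1 * \sum_(r <- s) c r * ind R (A r) x).
  by apply/funext => x; rewrite big_cons mul1r.
split; first by apply: L_lin => //; exact: L_ind.
by rewrite phi_lin ?mul1r//; exact: L_ind.
Qed.

Lemma phi_simple f : simple f -> phi f = sint m f.
Proof.
move=> sf; rewrite /sint fsbig_finite//=.
have [_ <-] := phi_sum_ind id (fun r => f @^-1` [set r]) (fset_set (range f)).
congr phi; apply/funext => x.
rewrite (bigD1_seq (f x)) ?fset_uniq//=; last first.
  have : [set` fset_set (range f)] (f x) by rewrite fset_setK//; exists x.
  by [].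
have -> : ind R (f @^-1` [set f x]) x = 1 by rewrite /ind asboolT.
rewrite mulr1 big1 ?addr0// => r rf.
rewrite /ind asboolF ?mulr0// => /= frx.
by rewrite frx eqxx in rf.
Qed.

Lemma phi_min_is_cvg g : L g -> (forall x, 0 <= g x) ->
  cvgn (fun n : nat => phi (fun x => Num.min (g x) n%:R)).
Proof.
move=> Lg g0; have [_ _ _ _ Lmin] := HL.
have Ln n : L (fun x => Num.min (g x) n%:R) by apply: Lmin => //; exact: L_cst.
apply: nondecreasing_is_cvgn.
  move=> n k nk; apply: phi_le => // x.
  by rewrite le_min !ge_min lexx /= ler_nat nk orbT.
exists (phi g) => _ [n _ <-]; apply: phi_le => // x.
by rewrite ge_min lexx.
Qed.

(** The positive and negative parts are truncated separately; each yields a nondecreasing sequence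
    bounded by [phi] of that part. *)
Lemma phi_trunc_is_cvg h : L h -> cvgn (fun n : nat => phi (trunc n h)).
Proof.
move=> Lh; have [_ _ LZ Lmax Lmin] := HL.
have Lp : L (fun x => Num.max (h x) 0) by apply: Lmax => //; exact: L_cst.
have LN : L (fun x => - h x).
  by have := LZ (-1) _ Lh; under eq_fun do rewrite mulN1r.
have Ln : L (fun x => Num.max (- h x) 0).
  by apply: (Lmax (fun x => - h x)) => //; exact: L_cst.
have -> : (fun n : nat => phi (trunc n h)) = (fun n : nat =>
    phi (fun x => Num.min (Num.max (h x) 0) n%:R) -
    phi (fun x => Num.min (Num.max (- h x) 0) n%:R)).
  apply/funext => n; rewrite -phiB//.
    exact: (Lmin _ _ Lp (L_cst n%:R)).
  exact: (Lmin _ _ Ln (L_cst n%:R)).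
by apply: is_cvgB; apply: phi_min_is_cvg => // x; rewrite le_max lexx orbT.
Qed.

(** Supplies the uniform errors allowed when truncations are replaced by simple functions. *)
Lemma exists_null_seq : exists d : nat -> R, (forall n, 0 < d n) /\
  forall k e : R, 0 < e -> exists N, forall n, (N <= n)%N -> d n * k < e.
Proof.
exists (fun n => n.+1%:R^-1); split=> [n|k e e0]; first by rewrite invr_gt0.
have [N HN] := nat_above (k / e); exists N => n /HN.
rewrite ler_pdivrMr// => h; rewrite mulrC ltr_pdivrMr//; apply: le_lt_trans h _.
by rewrite mulrC ltr_pM2l// ltr_nat.
Qed.

(** Reduces the Cauchy property in mean of the truncations to the convergence of
    [phi (min |h| n)]. *)
Lemma clip_diff n k (y : R) : (k <= n)%N ->
  `|clip n y - clip k y| <= Num.min `|y| n%:R - Num.min `|y| k%:R.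
Proof.
rewrite -(ler_nat R) => kn; have k0 : 0 <= k%:R :> R by [].
rewrite !clipE !minEle !maxEle; case: (ger0P y) => y0;
  repeat (case: ifPn; rewrite -?ltNge); rewrite ler_norml; lra.
Qed.

(* The integral is approximated by functions taking finitely many values and
   close to the truncations; Chebyshev's inequality gives convergence in
   measure, monotone convergence of phi (min |h| n) the Cauchy property. *)
Lemma phi_is_DSint h : L h ->
  is_DSint m h (limn (fun n : nat => phi (trunc n h))).
Proof.
move=> Lh; set v := limn _.
have [_ _ _ _ Lmin] := HL.
have clipM n x : `|trunc n h x| <= n%:R.
  rewrite -[trunc n h x]/(clip n (h x)) clipE ler_norml.
  have n0 : 0 <= n%:R :> R by [].
  by rewrite !minEle !maxEle; repeat (case: ifPn; rewrite -?ltNge); lra.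
have [d [d0 dsmall]] := exists_null_seq.
have /choice[s Hs] n := bounded_simple_approx (clipM n) (d0 n).
have ss n : simple (s n) := (Hs n).1.
have Ls n : L (s n) by exact: L_simple.
have Lt n : L (trunc n h) by exact: L_trunc.
pose c := phi (fun _ => 1).
have Labs := L_abs Lh.
have Lm (n : nat) : L (fun x => Num.min `|h x| n%:R) by apply: (Lmin _ _ Labs); exact: L_cst.
exists s; split; last first.
  apply/cvg_seqP => e e0; have e2 : 0 < e / 2 by rewrite divr_gt0.
  have /cvg_seqP/(_ _ e2)[N1 HN1] := phi_trunc_is_cvg Lh.
  have [N2 HN2] := dsmall c _ e2.
  exists (maxn N1 N2) => n; rewrite geq_max => /andP[/HN1 h1 /HN2 h2].
  have := phi_dist (Ls n) (Lt n) (L_cst (d n)) (Hs n).2.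
  rewrite phi_cst -/c -phi_simple//; rewrite -/v in h1.
  move=> h3; rewrite -[_ - v](subrKA (phi (trunc n h))).
  apply: le_lt_trans (ler_normD _ _) _.
  by rewrite (splitr e); apply: ltrD => //; exact: le_lt_trans h3 h2.
split=> //.
- move=> e e0; apply/cvg_seqP => t t0.
  (* The added 1 makes [n * t] strictly larger than [phi |h|], which contradicts Chebyshev's bound
     if the measure is at least [t]. *)
  have [N1 HN1] := nat_above (phi (fun x => `|h x|) / t + 1).
  have [N2 HN2] := dsmall 1 _ e0.
  exists (maxn N1 N2) => n; rewrite geq_max => /andP[/HN1 h1 /HN2 h2].
  rewrite subr0 ger0_norm//.
  (* Where [|h| <= n] the truncation is [h] itself, and [s n] is within [d n < e] of it. *)
  apply: le_lt_trans (_ : m [set x | n%:R < `|h x|] < _).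
    apply: finadd_le => // x /= ex; rewrite ltNge; apply/negP => hn.
    have := (Hs n).2 x; rewrite -[trunc n h x]/(clip n (h x)) clip_id//.
    by rewrite mulr1 in h2; rewrite leNgt (lt_trans h2 ex).
  set A := [set x | _].
  have nA : n%:R * m A <= phi (fun x => `|h x|).
    have := phi_lin n%:R 0 (L_ind A) (L_ind A); rewrite mul0r addr0 => <-.
    apply: phi_le => //; first by apply: L_lin; exact: L_ind.
    move=> x; rewrite mul0r addr0 /ind; case: asboolP => [/ltW|_].
      by rewrite mulr1.
    by rewrite mulr0.
  rewrite ltNge; apply/negP => dA.
  have : n%:R * t <= n%:R * m A by rewrite ler_wpM2l.
  have : (phi (fun x => `|h x|) / t + 1) * t <= n%:R * t by rewrite ler_pM2r.
  by rewrite mulrDl divfK ?gt_eqF//; lra.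
(* Two quarters for the errors [d n] and [d k], two for the distances of the monotone sequence to
   its limit. *)
- move=> e e0; have e4 : 0 < e / 4 by rewrite divr_gt0.
  have /cvg_seqP := phi_min_is_cvg Labs (fun x => normr_ge0 (h x)).
  move=> /(_ _ e4)[N1 HN1]; set l := limn _ in HN1.
  have [N2 HN2] := dsmall c _ e4.
  have key n k : (k <= n)%N -> (maxn N1 N2 <= n)%N -> (maxn N1 N2 <= k)%N ->
      sint m (fun x => `|s n x - s k x|) < e.
    move=> kn; rewrite !geq_max => /andP[/HN1 n1 /HN2 n2] /andP[/HN1 k1 /HN2 k2].
    have sd : simple (fun x => `|s n x - s k x|).
      exact: (simple_comp2 (fun y z => `|y - z|)).
    rewrite -phi_simple//.
    have Lb : L (fun x => 1 * ((d n) + (d k)) +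
        1 * (Num.min `|h x| n%:R - Num.min `|h x| k%:R)).
      by apply: L_lin; [exact: L_cst|exact: L_sub].
    have : phi (fun x => `|s n x - s k x|) <=
        phi (fun x => 1 * ((d n) + (d k)) +
          1 * (Num.min `|h x| n%:R - Num.min `|h x| k%:R)).
      apply: phi_le => //; first exact: L_simple.
      move=> x; have := clip_diff (h x) kn.
      have := (Hs n).2 x; have := (Hs k).2 x.
      rewrite -[trunc n h x]/(clip n (h x)) -[trunc k h x]/(clip k (h x)).
      rewrite !ler_norml => /andP[? ?] /andP[? ?] /andP[? ?].
      by apply/andP; split; lra.
    rewrite phi_lin; [|exact: L_cst|exact: L_sub].
    rewrite phi_cst phiB// -/c.
    move: n1 k1; rewrite !ltr_norml => /andP[? ?] /andP[? ?]; lra.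
  exists (maxn N1 N2) => n k Nn Nk; have [kn|/ltnW nk] := leqP k n.
    exact: key.
  have := key _ _ nk Nk Nn; congr (_ < _); congr sint; apply/funext => x.
  exact: distrC.
Qed.

(** Truncations of a nonnegative [h] stay below [h]. This gives the positivity of [beta]. *)
Lemma phi_DSint_le h : L h -> (forall x, 0 <= h x) -> DSint m h <= phi h.
Proof.
move=> Lh h0; rewrite (DSintE m_ge0 mU (phi_is_DSint Lh)).
apply: limr_le; first exact: phi_trunc_is_cvg.
apply: nearW => n; apply: phi_le => //; first exact: L_trunc.
move=> x; have n0 : 0 <= n%:R :> R by [].
rewrite -[trunc n h x]/(clip n (h x)) clipE; have := h0 x.
by rewrite !minEle !maxEle; repeat (case: ifPn; rewrite -?ltNge); lra.
Qed.

(** For [n >= eta], the distance from [f] to its truncation is at most the excess of [|f|] over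
    [eta], on which [phi] is at most 0 because 0 dominates it. Hence [phi (trunc n f)] is eventually
    [phi f], and [beta] vanishes at [f]. *)
Lemma phi_DSint_bounded_star f : bounded_star ge f -> DSint m f = phi f.
Proof.
move=> Bf; have Lf := HBL Bf; have [eta [eta0 fe]] := Bf.
rewrite (DSintE m_ge0 mU (phi_is_DSint Lf)); apply: cvg_lim => //.
apply/cvg_seqP => e e0; have [N HN] := nat_above eta.
exists N => n /HN en; apply: le_lt_trans e0.
have [_ _ _ Lmax _] := HL.
have Lk : L (fun x => Num.max (`|f x| - eta) 0).
  apply: (Lmax (fun x => `|f x| - eta) _ _ (L_cst 0)).
  by apply: (L_sub _ (L_cst eta)); exact: L_abs.
have k0 : phi (fun x => Num.max (`|f x| - eta) 0) <= 0.
  by rewrite -[leRHS]phi0; apply: phi_mono => //; [exact: L_cst|exact: bounded_star_excess].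
apply: le_trans k0; apply: phi_dist => //; first exact: L_trunc.
move=> x; rewrite -[trunc n f x]/(clip n (f x)) clipE.
rewrite !minEle !maxEle; case: (ger0P (f x)) => ?;
  repeat (case: ifPn; rewrite -?ltNge); rewrite ler_norml; lra.
Qed.

End Functional.

(** * Finite sums, and linearity of the integral *)

Lemma linear_sum (J : (Omega -> R) -> R) (N : nat) (f : nat -> Omega -> R) :
  (forall (a b : R) f g, L f -> L g ->
     J (fun x => a * f x + b * g x) = a * J f + b * J g) ->
  (forall n, (n < N)%N -> L (f n)) ->
  L (fun x => \sum_(n < N) f n x) /\
  J (fun x => \sum_(n < N) f n x) = \sum_(n < N) J (f n).
Proof.
move=> Jlin; elim: N => [_|N IH Lf].
  under eq_fun do rewrite big_ord0; rewrite big_ord0; split; first exact: L_cst.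
  have -> : (fun=> 0) = (fun _ : Omega => 0 * 0 + 0 * 0 : R) by apply/funext => x; ring.
  by rewrite (Jlin 0 0 _ _ (L_cst 0) (L_cst 0)); ring.
have [LN JN] := IH (fun n nN => Lf n (ltnW nN)).
have LfN := Lf N (ltnSn N).
have -> : (fun x => \sum_(n < N.+1) f n x) =
    (fun x => 1 * (\sum_(n < N) f n x) + 1 * f N x).
  by apply/funext => x; rewrite big_ord_recr /= !mul1r.
split; first exact: L_lin.
by rewrite Jlin// JN !mul1r big_ord_recr.
Qed.

End StarOrder.

Lemma subadditive_sum (R : realType) (Omega : Type) (L : set (Omega -> R))
    (p : (Omega -> R) -> R) (N : nat) (f : nat -> Omega -> R) :
  (forall f g, L f -> L g -> L (fun x => f x + g x)) ->
  L (fun _ => 0) -> p (fun _ => 0) = 0 ->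
  (forall f g, L f -> L g -> p (fun x => f x + g x) <= p f + p g) ->
  (forall n, (n < N)%N -> L (f n)) ->
  p (fun x => \sum_(n < N) f n x) <= \sum_(n < N) p (f n).
Proof.
move=> LD L0 p0 psub Lf.
suff [] : L (fun x => \sum_(n < N) f n x) /\
  p (fun x => \sum_(n < N) f n x) <= \sum_(n < N) p (f n) by [].
elim: N Lf => [_|N IH Lf].
  by under eq_fun do rewrite big_ord0; rewrite big_ord0 p0.
have [LN pN] := IH (fun n nN => Lf n (ltnW nN)).
have LfN := Lf N (ltnSn N).
have -> : (fun x => \sum_(n < N.+1) f n x) = (fun x => (\sum_(n < N) f n x) + f N x).
  by apply/funext => x; rewrite big_ord_recr.
split; first exact: LD.
by rewrite big_ord_recr /= (le_trans (psub _ _ LN LfN))// lerD2r.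
Qed.

Lemma L1_DSint (R : realType) (Omega : Type) (m : set Omega -> R)
    (f : Omega -> R) :
  (forall A, 0 <= m A) ->
  (forall A B, A `&` B = set0 -> m (A `|` B) = m A + m B) ->
  L1 m f -> is_DSint m f (DSint m f).
Proof. by move=> m0 mU [v fv]; rewrite (DSintE m0 mU fv). Qed.

Lemma DSint_lin (R : realType) (Omega : Type) (m : set Omega -> R) (a b : R)
    (f g : Omega -> R) :
  (forall A, 0 <= m A) ->
  (forall A B, A `&` B = set0 -> m (A `|` B) = m A + m B) ->
  L1 m f -> L1 m g ->
  DSint m (fun x => a * f x + b * g x) = a * DSint m f + b * DSint m g.
Proof.
move=> m0 mU fL gL; apply: DSintE => //.
by apply: is_DSint_lin => //; exact: L1_DSint.
Qed.

(** * From additivity on a convex set to a linear minorant *)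

Section AdditiveOnConvex.
Variables (R : realType) (V : lmodType R) (L C : set V) (p : V -> R).
Hypotheses (Ls : submodule L) (ps : sublinear_on L p) (CL : C `<=` L) (C0 : C 0)
  (Cconv : forall x y (t : R), C x -> C y -> 0 <= t <= 1 ->
     C (t *: x + (1 - t) *: y))
  (pC : forall x y, C x -> C y -> p (x + y) = p x + p y).

(** For [a, b > 0], the vectors [a *: x] and [b *: y] divided by [a + b] are shrunk points of [C],
    hence in [C] as it is convex and contains 0. Additivity there, multiplied by [a + b], is
    additivity on the cone spanned by [C]. *)
Lemma hahn_banach_convex :
  exists phi, [/\ linear_on L phi, (forall x, L x -> phi x <= p x) &
    (forall x, C x -> phi x = p x)].
Proof.
have pZ := sublinear_onZ Ls ps; have [L0 LD LZ] := Ls.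
pose K := [set z : V | exists (a : R) x, [/\ 0 < a, C x & z = a *: x]].
have CZ (t : R) x : C x -> 0 <= t <= 1 -> C (t *: x).
  by move=> Cx t01; have := Cconv Cx C0 t01; rewrite scaler0 addr0.
have frac (a b : R) : 0 < a -> 0 < b ->
    [/\ 0 <= a / (a + b) <= 1, 1 - a / (a + b) = b / (a + b),
        (a + b) * (a / (a + b)) = a & (a + b) * (b / (a + b)) = b].
  move=> a0 b0; have ab : 0 < a + b by rewrite addr_gt0.
  have ab' : a + b != 0 by rewrite gt_eqF.
  split; [|by field|by field|by field].
  by rewrite divr_ge0 ?(ltW a0) ?(ltW ab)//= ler_pdivrMr// mul1r lerDl ltW.
have [|||||phi [phil phip phiK]] := @hahn_banach_cone R V L K p Ls ps.
- by move=> _ [a [x [_ /CL Lx ->]]]; exact: LZ.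
- by exists 1, 0; rewrite scale1r.
- move=> _ _ [a [x [a0 Cx ->]]] [b [y [b0 Cy ->]]].
  have [t01 tE aE bE] := frac _ _ a0 b0.
  exists (a + b), (a / (a + b) *: x + b / (a + b) *: y); split.
  + by rewrite addr_gt0.
  + by rewrite -tE; exact: Cconv.
  + by rewrite scalerDr !scalerA aE bE.
- move=> a _ a0 [b [x [b0 Cx ->]]]; exists (a * b), x; split=> //.
    by rewrite mulr_gt0.
  by rewrite scalerA.
- move=> _ _ [a [x [a0 Cx ->]]] [b [y [b0 Cy ->]]].
  have [t01 tE aE bE] := frac _ _ a0 b0; have ab : 0 < a + b by rewrite addr_gt0.
  have [s01 _ _ _] := frac _ _ b0 a0; rewrite addrC in s01.
  have Cx' := CZ _ _ Cx t01; have Cy' := CZ _ _ Cy s01.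
  have -> : a *: x + b *: y = (a + b) *: (a / (a + b) *: x + b / (a + b) *: y).
    by rewrite scalerDr !scalerA aE bE.
  have Lx' := CL Cx'; have Ly' := CL Cy'.
  rewrite (pZ _ _ ab (LD _ _ Lx' Ly')) pC// mulrDr -(pZ _ _ ab Lx') -(pZ _ _ ab Ly').
  by rewrite !scalerA aE bE.
exists phi; split=> // x Cx; apply: phiK; exists 1, x; split=> //.
by rewrite scale1r.
Qed.

End AdditiveOnConvex.

Theorem theorem9 (R : realType) (Omega : Type) (w0 : Omega)
  (ge : (Omega -> R) -> (Omega -> R) -> Prop) (Hge : star_order ge)
  (L : set (Omega -> R)) (HL : vector_lattice L)
  (HBL : bounded_star ge `<=` L)
  (C : set (Omega -> R)) (HCL : C `<=` L) (HC : convexF C)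
  (HC0 : C (fun _ => 0))
  (gamma : (Omega -> R) -> R)
  (Hmono : forall f g, L f -> L g -> ge f g -> gamma g <= gamma f)
  (Hsub : forall f g, L f -> L g -> gamma (fun x => f x + g x) <= gamma f + gamma g)
  (Hhom : forall (a : R) f, 0 < a -> L f -> gamma (fun x => a * f x) = a * gamma f) :
  (forall (N : nat) (f : nat -> Omega -> R), (forall n, (n < N)%N -> C (f n)) ->
     gamma (fun x => \sum_(n < N) f n x) = \sum_(n < N) gamma (f n))
  <->
  (exists beta : (Omega -> R) -> R,
     [/\ (forall (a b : R) f g, L f -> L g ->
            beta (fun x => a * f x + b * g x) = a * beta f + b * beta g),
         (forall f, L f -> (forall x, 0 <= f x) -> 0 <= beta f),
         (forall f, bounded_star ge f -> beta f = 0) &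
     exists m : set Omega -> R,
       [/\ ba_star_plus ge m, L `<=` L1 m,
           (forall h, L h -> ((beta h)%:E + pint m h <= (gamma h)%:E)%E) &
           (forall f, C f -> (gamma f)%:E = ((beta f)%:E + pint m f)%E)]]).
Proof.
have [L0 LD LZ _ _] := HL.
have Ls : submodule (L : set (Omega -> R)) by split.
have gs : sublinear_on (L : set (Omega -> R)) gamma.
  by split=> // a x a0 Lx; rewrite -[leRHS]Hhom.
have g0 : gamma (fun _ => 0) = 0 := sublinear_on0 Ls gs.
split=> [add|[beta [blin bpos bB [m [[m0 mb mU mN] mL gm gC]]]] N f Cf].
  have add2 f g : C f -> C g -> gamma (fun x => f x + g x) = gamma f + gamma g.
    move=> Cf Cg; have := add 2 (fun n => if n is 0%N then f else g).
    rewrite !big_ord_recr /= big_ord0 add0r => <-; last by case=> [|[|]].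
    by congr gamma; apply/funext => x; rewrite !big_ord_recr /= big_ord0 add0r.
  have [phi [phil phig phiC]] := hahn_banach_convex Ls gs HCL HC0 HC add2.
  have phi_lin (a b : R) f g : L f -> L g ->
    phi (fun x => a * f x + b * g x) = a * phi f + b * phi g by exact: phil.
  (* [ge f g] gives [ge 0 (g - f)] by CONE, so [phi (g - f) <= gamma (g - f) <= gamma 0 = 0]. *)
  have phi_mono f g : L f -> L g -> ge f g -> phi g <= phi f.
    move=> Lf Lg fg; rewrite -subr_le0.
    have [refl _ [_ cone _ _ _]] := Hge.
    have gf : ge (fun _ => 0) (fun x => g x - f x).
      have := cone _ _ _ _ 1 1 fg (refl (fun x => - f x)) ler01 ler01.
      rewrite (_ : (fun x => 1 * f x + _) = (fun=> 0)); last by apply/funext => x; ring.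
      rewrite (_ : (fun x => 1 * g x + _) = (fun x => g x - f x))//.
      by apply/funext => x; ring.
    have Lgf : L (fun x => g x - f x) by exact: L_sub HL _ _ Lg Lf.
    have <- : phi (fun x => g x - f x) = phi g - phi f by exact: phiB phi_lin _ _ Lg Lf.
    by rewrite -g0; apply: le_trans (phig _ Lgf) (Hmono _ _ L0 Lgf gf).
  pose m (A : set Omega) := phi (ind R A).
  have mba : ba_star_plus ge m := phi_ind_ba Hge HBL phi_lin phi_mono.
  have [m0 mb mU mN] := mba.
  have mL : L `<=` L1 m.
    move=> h Lh; exists (limn (fun n : nat => phi (trunc n h))).
    exact: phi_is_DSint phi_mono _ Lh.
  have pintL h : L h -> pint m h = (DSint m h)%:E.
    by move=> Lh; apply: pintE => //; apply: L1_DSint => //; exact: mL.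
  exists (fun h => phi h - DSint m h); split.
  - move=> a b f g Lf Lg; rewrite phi_lin// DSint_lin//; [ring|exact: mL|exact: mL].
  - by move=> f Lf f0; rewrite subr_ge0; exact: phi_DSint_le phi_mono _ Lf f0.
  - by move=> f Bf; rewrite (phi_DSint_bounded_star Hge HL HBL phi_lin phi_mono Bf) subrr.
  - exists m; split=> // [h Lh|f Cf].
      by rewrite pintL// -EFinD subrK lee_fin phig.
    by rewrite pintL -?EFinD ?subrK ?phiC//; exact: HCL.
have pintL h : L h -> pint m h = (DSint m h)%:E.
  by move=> Lh; apply: pintE => //; apply: L1_DSint => //; exact: mL.
pose J h := beta h + DSint m h.
have Jlin (a b : R) f1 f2 : L f1 -> L f2 ->
    J (fun x => a * f1 x + b * f2 x) = a * J f1 + b * J f2.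
  by move=> Lf Lg; rewrite /J blin// DSint_lin//; [ring|exact: mL|exact: mL].
have JC g : C g -> gamma g = J g.
  by move=> Cg; apply/EFin_inj; rewrite gC// pintL//; exact: HCL.
have Lf n : (n < N)%N -> L (f n) by move=> nN; apply: HCL; exact: Cf.
(* One inequality is subadditivity of [gamma]. For the other, the sum of the [gamma (f n)] is [J] of
   the sum, and [J] lies below [gamma] on [L]. *)
apply/eqP; rewrite eq_le; apply/andP; split.
  exact: subadditive_sum LD L0 g0 Hsub Lf.
have [LS JS] := linear_sum Hge HL HBL Jlin Lf.
have -> : \sum_(n < N) gamma (f n) = \sum_(n < N) J (f n).
  by apply: eq_bigr => n _; apply: JC; exact: Cf.
by rewrite -JS -lee_fin -[leLHS]/((beta _)%:E + (DSint m _)%:E)%E -pintL// gm.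
Qed.
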